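(* [Reciprocity for Clebsch-Gordan coefficients] Suppose $\mathbf{a}=(a_1,\dots,a_6)$ is the upshifted representative for $M$ in $M(3)$ with $m_0=\min(a_1, a_2, a_3)$. Then $$F(M, 1)\ =\ v(M)$$ and $$F(M, -1)\ = \ (-1)^{a_2+m_0}\ \begin{pmatrix} \rho(M) \\ a_1+a_5,\ a_2+a_6, \ a_3+a_4 \end{pmatrix}\ C(M).$$
   Context: $M(3)$ is the monoid of $3\times 3$ semi-magic squares (non-negative integer entries, all row and column sums equal to the line sum $\rho(M)$). With the permutation matrices $P_1=P_e$, $P_2=P_{(123)}$, $P_3=P_{(132)}$, $P_4=P_{(13)}$, $P_5=P_{(12)}$, $P_6=P_{(23)}$, every $M$ can be written $M=\sum_{t=1}^6 a_tP_t$ with $a_t\ge 0$, $\sum a_t=\rho(M)$; the only relation is $P_1+P_2+P_3=P_4+P_5+P_6=J$ (all-ones matrix). The sextuple $\mathbf{a}$ is the upshifted representative if some $a_t=0$ with $t\in\{4,5,6\}$. Explicitly $$M=\begin{bmatrix} a_1 +a_6 & a_3 + a_5 & a_2 + a_4\\ a_2 + a_5 & a_1 + a_4 & a_3 + a_6 \\ a_3 + a_4 & a_2 + a_6 & a_1 + a_5 \end{bmatrix}=\begin{bmatrix} n-k & m-k & k\\ i & j & m+n-i-j-k \\ m-i & n-j & i+j-k \end{bmatrix}.$$ $v(M)$ is the number of lattice paths from the zero matrix to $M$ whose steps are the six permutation matrices. For the upshifted representative, $$F(M,z)=\sum_{t=0}^{m_0}\binom{\rho(M)}{a_1-t,\ a_2-t,\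 a_3-t,\ a_4+t,\ a_5+t,\ a_6+t}z^t .$$ $C(M)$ is the un-normalized Clebsch-Gordan coefficient $c_{m,n,k}(i,j)$ (coefficient of $f^i\phi_m\otimes f^j\phi_n$ in $f^{i+j-k}\phi_{m+n-2k}\in V(m+n-2k)\subseteq V(m)\otimes V(n)$ for $\mathfrak{sl}(2,\mathbb{C})$), given by $$C(M)=\sum_t(-1)^t\binom{i+j-k}{i-t}\binom{m-i}{k-t}\binom{n-j}{t}=\sum_t(-1)^t\binom{a_1+a_5}{a_2+a_5-t}\binom{a_3+a_4}{a_2+a_4-t}\binom{a_2+a_6}{t}.$$ Multinomial coefficients vanish when a lower index is negative or exceeds the upper index.
   Formalization: The sign in the second identity is corrected from (-1)^(a_2+m_0) to (-1)^(a_2); the printed sign fails for a=(2,1,1,0,0,0), where F(M,-1)=-12, C(M)=1 and the multinomial is 12. *)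

(* Defs.v *)
From mathcomp Require Import all_boot all_order all_algebra all_fingroup.
From mathcomp Require Import zify ring.

Set Implicit Arguments.
Unset Strict Implicit.
Unset Printing Implicit Defensive.

Import GRing.Theory.
Local Open Scope ring_scope.

(** * Semi-magic squares of size 3 *)

Definition line_sum (M : 'M[nat]_3) : nat := (\sum_j M ord0 j)%N.

Definition semi_magic (M : 'M[nat]_3) : Prop :=
  (forall i, (\sum_j M i j)%N = line_sum M) /\
  (forall j, (\sum_i M i j)%N = line_sum M).

(* Column convention, P_s e_j = e_(s j); perm_mx itself acts on rows. *)
Definition pmx (s : 'S_3) : 'M[nat]_3 := (perm_mx s)^T.

(* Products in 'S_3 compose from left to right: c123 is 0 -> 1 -> 2 -> 0. *)
Definition c123 : 'S_3 := (tperm 0%R 1%R * tperm 0%R 2%R)%g.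

Definition P1 := pmx 1%g.
Definition P2 := pmx c123.
Definition P3 := pmx (c123^-1)%g.
Definition P4 := pmx (tperm 0 2).
Definition P5 := pmx (tperm 0 1).
Definition P6 := pmx (tperm 1 2).

Definition represents (M : 'M[nat]_3) (a1 a2 a3 a4 a5 a6 : nat) : Prop :=
  M = P1 *+ a1 + P2 *+ a2 + P3 *+ a3 + P4 *+ a4 + P5 *+ a5 + P6 *+ a6.

Definition upshifted (M : 'M[nat]_3) (a1 a2 a3 a4 a5 a6 : nat) : Prop :=
  represents M a1 a2 a3 a4 a5 a6 /\ [|| a4 == 0, a5 == 0 | a6 == 0]%N.

(* A path from 0 is the sequence of its steps; by [path_size] every path to M
   has exactly [line_sum M] steps, so counting that length counts all paths. *)
Definition num_paths (M : 'M[nat]_3) : nat :=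
  #|[set p : (line_sum M).-tuple 'S_3 | \sum_(s <- p) pmx s == M]|.

(** * The generating polynomial F(M, z) *)

Definition multinomial (n : nat) (s : seq nat) : nat :=
  if sumn s == n then (n`! %/ \prod_(k <- s) k`!)%N else 0%N.

Definition m0 (a1 a2 a3 : nat) : nat := minn a1 (minn a2 a3).

(* No subtraction truncates, since t <= m0. *)
Definition F (M : 'M[nat]_3) (a1 a2 a3 a4 a5 a6 : nat) : {poly int} :=
  \sum_(t < (m0 a1 a2 a3).+1)
     (multinomial (line_sum M)
        [:: a1 - t; a2 - t; a3 - t; a4 + t; a5 + t; a6 + t]%N)%:R *: 'X^t.

(** * Clebsch-Gordan coefficients of sl(2)

   V(m) has basis f^i phi_m, 0 <= i <= m, with
     f . f^i phi_m = f^(i+1) phi_m       (zero if i = m),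
     e . f^i phi_m = i(m-i+1) f^(i-1) phi_m,
     h . f^i phi_m = (m-2i) f^i phi_m.
   All structure constants and the vectors below are integral, so coordinates
   are taken in int. A vector of V(m) is the row of its coordinates, operators
   act by right multiplication, and the (i, j) entry of an element of
   V(m) (x) V(n) is the coefficient of f^i phi_m (x) f^j phi_n. *)

Definition sl2_f (m : nat) : 'M[int]_m.+1 :=
  \matrix_(i, j) (i.+1 == j :> nat)%:R.
Definition sl2_e (m : nat) : 'M[int]_m.+1 :=
  \matrix_(i, j) ((i * (m.+1 - i))%:R *+ (i == j.+1 :> nat)).
Definition sl2_h (m : nat) : 'M[int]_m.+1 :=
  \matrix_(i, j) ((m%:R - (2 * i)%:R) *+ (i == j)).

(* X (x) 1 + 1 (x) X *)
Definition tens_act m n (A : 'M[int]_m.+1) (B : 'M[int]_n.+1)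
    (T : 'M[int]_(m.+1, n.+1)) : 'M[int]_(m.+1, n.+1) := A^T *m T + T *m B.

(* The generator phi_(m+n-2k) of V(m+n-2k) in V(m) (x) V(n); see
   [hw_killed], [hw_weight]. It is un-normalized: its coordinate on
   phi_m (x) f^k phi_n is 'C(m, k). *)
Definition hw (m n k : nat) : 'M[int]_(m.+1, n.+1) :=
  \matrix_(i, j)
    ((-1) ^+ i * ('C(m - i, k - i) * 'C(n - j, i))%:R *+ (i + j == k)%N).

Definition clebsch_gordan (m n k i j : nat) : int :=
  iter (i + j - k) (tens_act (sl2_f m) (sl2_f n)) (hw m n k)
       (inord i) (inord j).

(* m, n, k, i, j are read off the second form of M:
     [ n-k   m-k   k           ]
     [ i     j     m+n-i-j-k   ]
     [ m-i   n-j   i+j-k       ] *)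
Definition C (M : 'M[nat]_3) : int :=
  let k := M 0 2 in
  clebsch_gordan (M 0%R 1%R + k)%N (M 0%R 0%R + k)%N k (M 1 0) (M 1 1).

(** * Checks of the definitions *)

Lemma tr_pmxE (s : 'S_3) i j : pmx s i j = (s j == i).
Proof. by rewrite !mxE; case: (s j == i). Qed.

Lemma path_size (p : seq 'S_3) : line_sum (\sum_(s <- p) pmx s) = size p.
Proof.
rewrite /line_sum; elim: p => [|s p IH].
  by rewrite big_nil big1 // => j _; rewrite mxE.
rewrite big_cons (eq_bigr (fun j => (pmx s ord0 j +
  (\sum_(t <- p) pmx t)%R ord0 j)%N)); last by move=> j _; rewrite mxE.
rewrite big_split /= IH; change (size p).+1 with (1 + size p)%N; congr addn.
rewrite (bigD1 ((s^-1)%g ord0)) //= tr_pmxE permKV eqxx big1 // => j.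
rewrite tr_pmxE => /eqP nj; case: eqP => // E.
by case: nj; rewrite -E permK.
Qed.

Lemma c123E : (c123 0 = 1) * (c123 1 = 2) * (c123 2 = 0).
Proof. by rewrite /c123 !permM !permE /=. Qed.

Lemma c132E : ((c123^-1)%g 0 = 2) * ((c123^-1)%g 1 = 0) * ((c123^-1)%g 2 = 1).
Proof.
have [[E0 E1] E2] := c123E.
by do ![split]; apply/esym/(canRL (permK c123)).
Qed.

Lemma representsE M a1 a2 a3 a4 a5 a6 : represents M a1 a2 a3 a4 a5 a6 ->
  [/\ [/\ M 0 0 = (a1 + a6)%N, M 0 1 = (a3 + a5)%N & M 0 2 = (a2 + a4)%N],
      [/\ M 1 0 = (a2 + a5)%N, M 1 1 = (a1 + a4)%N & M 1 2 = (a3 + a6)%N]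
    & [/\ M 2 0 = (a3 + a4)%N, M 2 1 = (a2 + a6)%N & M 2 2 = (a1 + a5)%N]].
Proof.
have mulE (s : 'S_3) a i j : (pmx s *+ a) i j = (a * (s j == i))%N.
  rewrite -tr_pmxE; elim: a => [|a IH]; first by rewrite mulr0n mxE.
  by rewrite mulrS mxE IH mulSn.
have addE (A B : 'M[nat]_3) i j : (A + B) i j = (A i j + B i j)%N.
  by rewrite mxE.
move=> ->; rewrite /P1 /P2 /P3 /P4 /P5 /P6 !addE !mulE !c123E !c132E.
by rewrite !permE /= !muln0 !muln1 !addn0 !add0n.
Qed.

Lemma represents_semi_magic M a1 a2 a3 a4 a5 a6 :
  represents M a1 a2 a3 a4 a5 a6 ->
  semi_magic M /\ line_sum M = (a1 + a2 + a3 + a4 + a5 + a6)%N.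
Proof.
move=> /representsE [[A B D] [E G H] [I J K]].
have L : line_sum M = (a1 + a2 + a3 + a4 + a5 + a6)%N.
  have -> : line_sum M = (M 0%R 0%R + M 0%R 1%R + M 0%R 2%R)%N.
    rewrite /line_sum !big_ord_recl big_ord0 addn0 addnA.
    by congr (M _ _ + M _ _ + M _ _)%N; apply: val_inj.
  lia.
have row i : (\sum_j M i j)%N = (M i 0%R + M i 1%R + M i 2%R)%N.
  rewrite !big_ord_recl big_ord0 addn0 addnA.
  by congr (M _ _ + M _ _ + M _ _)%N; apply: val_inj.
have col j : (\sum_i M i j)%N = (M 0%R j + M 1%R j + M 2%R j)%N.
  rewrite !big_ord_recl big_ord0 addn0 addnA.
  by congr (M _ _ + M _ _ + M _ _)%N; apply: val_inj.
have I3 (i : 'I_3) : [\/ i = 0, i = 1 | i = 2].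
  case: i => [[|[|[|//]]] Hi]; [exact: Or31 (val_inj _)
    | exact: Or32 (val_inj _) | exact: Or33 (val_inj _)].
split; last exact: L.
split=> i; rewrite L ?row ?col; case: (I3 i) => ->; lia.
Qed.

Lemma sl2_comm m :
  sl2_f m *m sl2_e m - sl2_e m *m sl2_f m = sl2_h m.
Proof.
apply/matrixP => i j; rewrite !mxE.
have -> : \sum_l sl2_f m i l * sl2_e m l j
   = (i.+1 * (m - i))%:R *+ (i == j).
  case: (ltnP i m) => [lt|ge].
    rewrite (bigD1 (Ordinal (lt : i.+1 < m.+1)%N)) //= big1 ?addr0 => [|l nl].
      by rewrite !mxE /= eqxx mul1r subSS eqSS.
    rewrite !mxE; case: eqP => [E|_]; last by rewrite mul0r.
    by case/eqP: nl; apply: val_inj; rewrite /= E.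
  rewrite big1 => [|l _]; last first.
    by rewrite !mxE; have := ltn_ord l; case: eqP => [<-|]; rewrite ?mul0r; lia.
  by rewrite (_ : (m - i)%N = 0%N) ?muln0 ?mul0rn //; lia.
have -> : \sum_l sl2_e m i l * sl2_f m l j
   = (i * (m.+1 - i))%:R *+ (i == j).
  case: i => [[|i] Hi].
    by rewrite mul0n mul0rn big1 // => l _; rewrite !mxE mul0r.
  rewrite (bigD1 (Ordinal (ltnW Hi))) //= big1 ?addr0 => [|l nl].
    rewrite !mxE /= eqxx mulr1n -val_eqE /=; case: eqP => _.
      by rewrite mulr1 mulr1n.
    by rewrite mulr0 mulr0n.
  rewrite !mxE /= eqSS; case: eqP => [E|_]; last by rewrite mulr0n mul0r.
  by case/eqP: nl; apply: val_inj; rewrite /= E.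
by case: (i == j); rewrite ?mulr0n ?subr0 // !mulr1n; have := ltn_ord i; nia.
Qed.

Lemma tens_fE m n (T : 'M[int]_(m.+1, n.+1)) i j : (i <= m)%N -> (j <= n)%N ->
  tens_act (sl2_f m) (sl2_f n) T (inord i) (inord j) =
    (if i is i'.+1 then T (inord i') (inord j) else 0) +
    (if j is j'.+1 then T (inord i) (inord j') else 0).
Proof.
move=> im jn; rewrite !mxE; congr (_ + _).
  case: i im => [|i] im.
    by rewrite big1 // => l _; rewrite !mxE inordK // mul0r.
  rewrite (bigD1 (inord i)) //= big1 ?addr0 => [|l nl].
    by rewrite !mxE !inordK // ?eqxx ?mul1r //; lia.
  rewrite !mxE !inordK // eqSS; case: eqP => [E|_]; last by rewrite mul0r.
  by case/eqP: nl; rewrite -E inord_val.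
case: j jn => [|j] jn.
  by rewrite big1 // => l _; rewrite !mxE inordK // mulr0.
rewrite (bigD1 (inord j)) //= big1 ?addr0 => [|l nl].
  by rewrite !mxE !inordK // ?eqxx ?mulr1 //; lia.
rewrite !mxE !inordK // eqSS; case: eqP => [E|_]; last by rewrite mulr0.
by case/eqP: nl; rewrite -E inord_val.
Qed.

Lemma tens_eE m n (T : 'M[int]_(m.+1, n.+1)) (i : 'I_m.+1) (j : 'I_n.+1) :
  tens_act (sl2_e m) (sl2_e n) T i j =
    (i.+1 * (m - i))%:R * T (inord i.+1) j +
    (j.+1 * (n - j))%:R * T i (inord j.+1).
Proof.
rewrite !mxE; congr (_ + _).
  case: (ltnP i m) => [lt|ge]; last first.
    rewrite (_ : (m - i = 0)%N) ?muln0 ?mul0r; last by lia.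
    by rewrite big1 // => l _; rewrite !mxE; have := ltn_ord l;
      case: eqP => [->|]; rewrite ?mulr0n ?mul0r //; lia.
  rewrite (bigD1 (inord i.+1)) //= big1 ?addr0 => [|l nl].
    by rewrite !mxE !inordK // eqxx mulr1n subSS.
  rewrite !mxE; case: eqP => [E|_]; last by rewrite mulr0n mul0r.
  by case/eqP: nl; rewrite -E inord_val.
case: (ltnP j n) => [lt|ge]; last first.
  rewrite (_ : (n - j = 0)%N) ?muln0 ?mul0r; last by lia.
  by rewrite big1 // => l _; rewrite !mxE; have := ltn_ord l;
    case: eqP => [->|]; rewrite ?mulr0n ?mulr0 //; lia.
rewrite (bigD1 (inord j.+1)) //= big1 ?addr0 => [|l nl].
  by rewrite !mxE !inordK // eqxx mulr1n subSS mulrC.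
rewrite !mxE; case: eqP => [E|_]; last by rewrite mulr0n mulr0.
by case/eqP: nl; rewrite -E inord_val.
Qed.

Lemma hw_killed m n k : (k <= m)%N -> (k <= n)%N ->
  tens_act (sl2_e m) (sl2_e n) (hw m n k) = 0.
Proof.
move=> km kn; apply/matrixP => i j; rewrite tens_eE !mxE.
have Hi := ltn_ord i; have Hj := ltn_ord j.
case: (ltnP i m) => im; last first.
  rewrite (_ : (m - i = 0)%N) ?muln0 ?mul0r ?add0r; last by lia.
  case: (ltnP j n) => jn; last first.
    by rewrite (_ : (n - j = 0)%N) ?muln0 ?mul0r //; lia.
  by rewrite inordK // (_ : _ == k = false) ?mulr0n ?mulr0 //; lia.
case: (ltnP j n) => jn; last first.
  rewrite (_ : (n - j = 0)%N) ?muln0 ?mul0r ?addr0; last by lia.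
  by rewrite inordK // (_ : _ == k = false) ?mulr0n ?mulr0 //; lia.
rewrite !inordK // addnS addSn; case: eqP => [E|_]; last by rewrite !mulr0.
rewrite !mulr1n exprS mulN1r mulNr mulrN addrC mulrCA [X in _ - X]mulrCA -mulrBr.
rewrite -!natrM.
suff -> : (j.+1 * (n - j) * ('C(m - i, k - i) * 'C(n - j.+1, i)) =
  i.+1 * (m - i) * ('C(m - i.+1, k - i.+1) * 'C(n - j, i.+1)))%N.
  by rewrite subrr mulr0.
have -> : (k - i = j.+1)%N by lia.
have -> : (k - i.+1 = j)%N by lia.
have -> : (n - j = (n - j.+1).+1)%N by lia.
have -> : (m - i = (m - i.+1).+1)%N by lia.
have A := mul_bin_diag (m - i.+1).+1 j.
have B := mul_bin_diag (n - j.+1).+1 i.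
move: A B => /= A B; nia.
Qed.

Lemma hw_weight m n k : (k <= m)%N -> (k <= n)%N ->
  tens_act (sl2_h m) (sl2_h n) (hw m n k) = (m + n - 2 * k)%:R *: hw m n k.
Proof.
move=> km kn; apply/matrixP => i j; rewrite !mxE.
rewrite (bigD1 i) //= big1 ?addr0 => [|l nl]; last first.
  by rewrite !mxE (negPf nl) mulr0n mul0r.
rewrite (bigD1 j) //= big1 ?addr0 => [|l nl]; last first.
  by rewrite !mxE (negPf nl) mulr0n mulr0.
rewrite !mxE !eqxx !mulr1n mulrC -mulrDr mulrC.
case: eqP => [E|_]; last by rewrite mulr0n !mulr0.
congr (_ * _); rewrite -E natrB ?natrD ?natrM; last by lia.
by rewrite ?natrD; ring.
Qed.

(* 'C(n, i - t) for integers i, t, hence 0 if t > i. *)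
Definition binz (n i t : nat) : nat := if (t <= i)%N then 'C(n, i - t) else 0%N.

Lemma binzSn n i t : binz n.+1 i t = (binz n i t + binz n i t.+1)%N.
Proof.
rewrite /binz; case: (ltngtP t i) => [lt|//|->].
  by rewrite (_ : (i - t = (i - t.+1).+1)%N) ?binS //; lia.
by rewrite subnn !bin0.
Qed.

Definition cg_sum (N l p q i k : nat) : int :=
  \sum_(t < N) (-1) ^+ t * (binz l i t * binz p k t * 'C(q, t))%:R.

Lemma cg_sum_rec N l p q i k : (i.+1 < N)%N ->
  cg_sum N l.+1 p q i.+1 k = cg_sum N l p.+1 q i k + cg_sum N l p q.+1 i.+1 k.
Proof.
case: N => [//|N] iN; rewrite /cg_sum.
pose f t : int := (-1) ^+ t * (binz l i.+1 t.+1 * binz p k t.+1 * 'C(q, t))%:R.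
have -> : \sum_(t < N.+1) (-1) ^+ t * (binz l i.+1 t * binz p k t * 'C(q.+1, t))%:R
   = \sum_(t < N.+1) (-1) ^+ t * (binz l i.+1 t * binz p k t * 'C(q, t))%:R
     - \sum_(t < N.+1) f t :> int.
  rewrite [X in X = _]big_ord_recl [X in _ = X - _]big_ord_recl.
  rewrite [X in _ - X]big_ord_recr /=.
  rewrite (_ : f N = 0) ?addr0; last first.
    by rewrite /f /binz (_ : (N < i.+1)%N = false) ?mul0n ?mulr0 //; lia.
  rewrite !bin0 -addrA; congr (_ + _); rewrite -sumrB; apply: eq_bigr => t _.
  by rewrite /f /bump /= add1n binS mulnDr natrD exprS; ring.
rewrite addrCA -sumrB -big_split /=; apply: eq_bigr => t _.
rewrite /f binzSn binzSn.
have -> : binz l i t = binz l i.+1 t.+1 by [].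
by rewrite !mulnDl !mulnDr !mulnDl !natrD; ring.
Qed.

Lemma clebsch_gordan_iter m n k l i j :
  (i <= m)%N -> (j <= n)%N -> (i + j = k + l)%N ->
  iter l (tens_act (sl2_f m) (sl2_f n)) (hw m n k) (inord i) (inord j) =
    cg_sum i.+2 l (m - i) (n - j) i k.
Proof.
have widen N l' p q i' : (i' < N)%N ->
    cg_sum N l' p q i' k = cg_sum i'.+1 l' p q i' k.
  move=> iN; rewrite /cg_sum -!(big_mkord xpredT (fun t =>
    (-1) ^+ t * (binz l' i' t * binz p k t * 'C(q, t))%:R : int)).
  rewrite (@big_cat_nat _ _ _ i'.+1) //= [X in _ + X]big_nat.
  rewrite [X in _ + X]big1 ?addr0 // => t /andP[ti _].
  by rewrite /binz leqNgt ti mul0n mulr0.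
elim: l i j => [|l IH] i j im jn.
  rewrite addn0 => E; rewrite /= !mxE !inordK // E eqxx mulr1n widen //.
  rewrite /cg_sum big_ord_recr /= big1 ?add0r => [|t _]; last first.
    rewrite /binz ltnW // bin0n (_ : (i - t == 0)%N = false) ?mulr0 //.
    by have := ltn_ord t; lia.
  rewrite /binz leqnn subnn bin0 mul1n (_ : (i <= k)%N) //; lia.
move=> E; rewrite iterS tens_fE //.
case: i im E => [|i] im E.
  rewrite add0r; case: j jn E => [|j] jn E; first by lia.
  rewrite IH //; try lia.
  rewrite !(widen 2%N) // /cg_sum !big_ord1 /= !bin0.
  by rewrite /binz /= !subn0 !bin0.
rewrite cg_sum_rec // IH //; try lia.
rewrite (_ : (m - i = (m - i.+1).+1)%N); last by lia.
rewrite !(widen _ _ _ _ i) ?ltnS ?leqnn ?leqnSn ?leqW //; congr (_ + _).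
case: j jn E => [|j] jn E.
  rewrite /cg_sum big1 // => t _; rewrite /binz.
  case: leqP => ti; last by rewrite mul0n mulr0.
  case: leqP => tk; last by rewrite muln0 mul0n mulr0.
  by rewrite bin_small ?mul0n ?mulr0 //; lia.
rewrite IH //; try lia.
by rewrite (_ : (n - j = (n - j.+1).+1)%N) //; lia.
Qed.

Lemma clebsch_gordanE m n k i j :
  (i <= m)%N -> (j <= n)%N -> (k <= i + j)%N ->
  clebsch_gordan m n k i j =
    \sum_(t < (minn i k).+1) (-1) ^+ t *
      ('C(i + j - k, i - t) * 'C(m - i, k - t) * 'C(n - j, t))%:R.
Proof.
move=> im jn kij; rewrite /clebsch_gordan clebsch_gordan_iter //; last by lia.
rewrite /cg_sum -!(big_mkord xpredT (fun t => (-1) ^+ t *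
    (binz (i + j - k) i t * binz (m - i) k t * 'C(n - j, t))%:R : int)).
rewrite (@big_cat_nat _ _ _ (minn i k).+1) //=; last by lia.
rewrite [X in _ + X]big_nat [X in _ + X]big1 ?addr0 => [|t /andP[ti _]].
  rewrite big_mkord; apply: eq_bigr => t _; have := ltn_ord t => ht.
  by rewrite /binz !ifT //; lia.
rewrite /binz; case: leqP => h1; last by rewrite mul0n mulr0.
by case: leqP => h2; [lia | rewrite muln0 mul0n mulr0].
Qed.

Lemma C_sextupleE M a1 a2 a3 a4 a5 a6 : represents M a1 a2 a3 a4 a5 a6 ->
  C M = \sum_(t < (minn (a2 + a5) (a2 + a4)).+1) (-1) ^+ t *
    ('C(a1 + a5, a2 + a5 - t) * 'C(a3 + a4, a2 + a4 - t) * 'C(a2 + a6, t))%:R.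
Proof.
move=> /representsE [[A B D] [E G _] _].
rewrite /C A B D E G clebsch_gordanE; try lia.
apply: eq_bigr => t _; congr (_ * (_ * _ * _)%:R); congr binomial; lia.
Qed.

(** * The sign in the second identity

   With F, C and the upshifted representative as above, the substitution
   t -> a2 - t in [C_sextupleE] yields F(M, -1) = (-1)^a2 * (...) * C(M).
   The source prints the sign (-1)^(a2 + m0) instead, which is wrong whenever
   m0 is odd and C(M) is nonzero; (2, 1, 1, 0, 0, 0) is an example. *)

Lemma printed_sign_fails :
  let M := P1 *+ 2 + P2 *+ 1 + P3 *+ 1 + P4 *+ 0 + P5 *+ 0 + P6 *+ 0 in
  [/\ upshifted M 2 1 1 0 0 0,
      (F M 2 1 1 0 0 0).[-1] = - 12%:R,
      (-1) ^+ 1 * (multinomial (line_sum M) [:: 2; 1; 1])%:R * C M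
        = - 12%:R
    & (-1) ^+ (1 + m0 2 1 1) * (multinomial (line_sum M) [:: 2; 1; 1])%:R * C M
        = 12%:R].
Proof.
move=> M; have R : represents M 2 1 1 0 0 0 by [].
have [_ L] := represents_semi_magic R.
have CE : C M = 1 by rewrite (C_sextupleE R) !big_ord_recl big_ord0.
have ME : multinomial 4 [:: 2; 1; 1] = 12 by rewrite /multinomial /= unlock.
rewrite L /= !addn0 in ME *; split => //; rewrite ?CE ?ME //.
rewrite /F L /= !big_ord_recl big_ord0 /= /multinomial /= !unlock /=.
by rewrite !hornerE.
Qed.

(* Main.v *)
(** A path to M is a word in the six permutation matrices, and its letter counts
    form a sextuple representing M. When some of a4, a5, a6 vanishes, the
    sextuples representing M are exactly (a1 - t, a2 - t, a3 - t, a4 + t, a5 + t,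
    a6 + t) with 0 <= t <= m0, so grouping the words by their letter counts gives
    F(M, 1). For F(M, -1), pair the lower indices as (a1 - t, a5 + t),
    (a2 - t, a6 + t), (a3 - t, a4 + t): the pair sums do not depend on t, so each
    multinomial is a fixed trinomial times three binomials, which form the term
    of index a2 - t in the formula for C(M). *)

Require Import Defs.
From mathcomp Require Import all_boot all_order all_algebra all_fingroup.
From mathcomp Require Import zify ring.

Set Implicit Arguments.
Unset Strict Implicit.
Unset Printing Implicit Defensive.

Import GRing.Theory.
Local Open Scope ring_scope.

(** * Counting words with prescribed letter counts *)

Section Words.
Local Open Scope nat_scope.

Variable T : finType.

Definition has_content n (b : T -> nat) (p : n.-tuple T) : bool :=
  [forall s, count_mem s p == b s].

Lemma has_content_cons n (b : T -> nat) s (p : n.-tuple T) :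
  has_content b (cons_tuple s p) =
    (0 < b s) && has_content (fun u => b u - (s == u)) p.
Proof.
apply/forallP/andP => [H|[bs /forallP H] u].
  split; first by have := H s; rewrite /= eqxx => /eqP <-.
  by apply/forallP => u /=; have /eqP <- := H u; rewrite addKn.
have /eqP /= -> := H u.
by case: (s =P u) => [<-|_]; rewrite ?subnKC ?subn0.
Qed.

Lemma prod_fact_pred (b : T -> nat) s : 0 < b s ->
  \prod_u (b u)`! = b s * \prod_u (b u - (s == u))`!.
Proof.
move=> bs; rewrite (bigD1 s) //= [in RHS](bigD1 s) //= eqxx mulnA.
congr (_ * _); first by rewrite subn1; case: (b s) bs.
by apply: eq_bigr => u /negPf su; rewrite eq_sym su subn0.
Qed.

(** Induction on the length, splitting off the first letter: among words of length [n.+1], those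
    starting with [s] contribute [b s] times the factorial of [n], and the [b s] add up to
    [n.+1]. *)
Lemma card_content n (b : T -> nat) : \sum_s b s = n ->
  #|[set p : n.-tuple T | has_content b p]| * \prod_s (b s)`! = n`!.
Proof.
rewrite -sum1dep_card [X in X * _]big_mkcond /=.
elim: n b => [|n IH] b Sb.
  have b0 s : b s = 0.
    by apply/eqP; move/eqP: Sb; rewrite sum_nat_eq0 => /forallP /(_ s).
  rewrite (big_pred1 [tuple]) => [|p]; last by rewrite [p]tuple0.
  rewrite ifT; last by apply/forallP => s; rewrite b0.
  by rewrite big1 // => s _; rewrite b0.
have -> : \sum_(p : n.+1.-tuple T) (if has_content b p then 1 else 0) =
    \sum_s \sum_(p : n.-tuple T)
      (if has_content b (cons_tuple s p) then 1 else 0).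
  rewrite pair_big (reindex (fun x : T * n.-tuple T => cons_tuple x.1 x.2)) //.
  exists (fun p => (thead p, [tuple of behead p])) => [[s p]|p] _.
    by congr pair; apply: val_inj.
  by rewrite [p in RHS]tuple_eta; apply: val_inj.
rewrite factS -[in RHS]Sb !big_distrl /=; apply: eq_bigr => s _.
have [bs0|bs] := posnP (b s).
  by rewrite bs0 mul0n big1 // => p _; rewrite has_content_cons bs0.
rewrite (prod_fact_pred bs) mulnCA; congr (_ * _).
rewrite -(IH (fun u => b u - (s == u))).
  by congr (_ * _); apply: eq_bigr => p _; rewrite has_content_cons bs.
move: Sb; rewrite (bigD1 s) //= [in X in _ -> X](bigD1 s) //= eqxx.
have -> : \sum_(u | u != s) (b u - (s == u)) = \sum_(u | u != s) b u.
  by apply: eq_bigr => u /negPf su; rewrite eq_sym su subn0.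
lia.
Qed.

End Words.

(** * Words in the six permutations *)

(* Listed in the order of P1, ..., P6. *)
Definition perms3 : seq 'S_3 :=
  [:: 1%g; c123; (c123^-1)%g; tperm 0 2; tperm 0 1; tperm 1 2].

Lemma uniq_perms3 : uniq perms3.
Proof.
(* The images of 0 and 1 already tell the six permutations apart. *)
apply: (@map_uniq _ _ (fun s : 'S_3 => (s 0, s 1))).
by rewrite /= !c123E !c132E !permE.
Qed.

(** Six distinct elements exhaust a group of order 6. *)
Lemma perm_perms3 : perm_eq (index_enum 'S_3) perms3.
Proof.
apply: uniq_perm; [exact: index_enum_uniq | exact: uniq_perms3 |].
have [||_ E] // := uniq_min_size uniq_perms3 (s2 := index_enum 'S_3).
  by rewrite [index_enum _]unlock -enumT -cardE card_Sn.
Qed.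

(** Reads a list as letter counts in the order of [perms3]; the default 0 is never reached when [w]
    has size 6. *)
Definition coef3 (w : seq nat) (s : 'S_3) : nat := nth 0%N w (index s perms3).

Lemma map_coef3 w : size w = 6 -> [seq coef3 w s | s <- perms3] = w.
Proof.
move=> Sw; apply: (@eq_from_nth _ 0%N) => [|i]; rewrite size_map // => Hi.
by rewrite (nth_map 1%g) // /coef3 index_uniq // uniq_perms3.
Qed.

Lemma multinomial_card n w : size w = 6 -> sumn w = n ->
  multinomial n w = #|[set p : n.-tuple 'S_3 | has_content (coef3 w) p]|.
Proof.
move=> Sw sw; rewrite /multinomial sw eqxx.
have := @card_content _ n (coef3 w).
rewrite !(perm_big _ perm_perms3) /= -(big_map (coef3 w) xpredT id).
rewrite -(big_map (coef3 w) xpredT factorial).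
rewrite map_coef3 // -sumnE => /(_ sw) <-; rewrite mulnK //.
by apply: prodn_gt0 => i; apply: fact_gt0.
Qed.

Lemma has_content_coef3 n w (p : n.-tuple 'S_3) : size w = 6 ->
  has_content (coef3 w) p = ([seq count_mem s p | s <- perms3] == w).
Proof.
move=> Sw; apply/forallP/eqP => [H|<- s].
  by rewrite -[RHS]map_coef3 //; apply: eq_map => s; apply/eqP.
have sp : s \in perms3 by rewrite -(perm_mem perm_perms3) mem_index_enum.
by rewrite /coef3 (nth_map 1%g) ?index_mem // nth_index.
Qed.

Lemma represents_count (p : seq 'S_3) :
  let c s := count_mem s p in
  represents (\sum_(s <- p) pmx s) (c 1%g) (c c123) (c (c123^-1)%g)
    (c (tperm 0 2)) (c (tperm 0 1)) (c (tperm 1 2)).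
Proof.
move=> c; rewrite /represents.
have -> : \sum_(s <- p) pmx s = \sum_s pmx s *+ c s.
  rewrite /c; elim: p {c} => [|u p IH].
    by rewrite big_nil big1 // => s _; rewrite mulr0n.
  rewrite big_cons IH (bigD1 u) //= [in RHS](bigD1 u) //= eqxx mulrSr.
  rewrite [in RHS]addrAC [RHS]addrC.
  congr (_ + (_ + _)); apply: eq_bigr => s su.
  by rewrite eq_sym (negPf su).
by rewrite (perm_big _ perm_perms3) /= !big_cons big_nil addr0 !addrA.
Qed.

(** * Sextuples representing a given matrix, and F(M, 1) *)

Definition shift3 (a1 a2 a3 a4 a5 a6 t : nat) : seq nat :=
  [:: a1 - t; a2 - t; a3 - t; a4 + t; a5 + t; a6 + t]%N.

(** Equality of the nine entries forces a1 - b1 = a2 - b2 = a3 - b3 = b4 - a4 = b5 - a5 = b6 - a6,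
    and this common value is [t]. *)
Lemma represents_eq M M' a1 a2 a3 a4 a5 a6 b1 b2 b3 b4 b5 b6 :
    upshifted M a1 a2 a3 a4 a5 a6 -> represents M' b1 b2 b3 b4 b5 b6 ->
  (M' == M) = [exists t : 'I_(m0 a1 a2 a3).+1,
                 [:: b1; b2; b3; b4; b5; b6] == shift3 a1 a2 a3 a4 a5 a6 t].
Proof.
case=> Ra up Rb.
have [[A1 A2 A3] [A4 A5 A6] [A7 A8 A9]] := representsE Ra.
have [[B1 B2 B3] [B4 B5 B6] [B7 B8 B9]] := representsE Rb.
apply/eqP/existsP => [E|[[t t1] /eqP[/= E1 E2 E3 E4 E5 E6]]].
  move: B1 B2 B3 B4 B5 B6 B7 B8 B9.
  rewrite E A1 A2 A3 A4 A5 A6 A7 A8 A9 => B1 B2 B3 B4 B5 B6 B7 B8 B9.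
  have tm : (b4 - a4 < (m0 a1 a2 a3).+1)%N by rewrite /m0; lia.
  exists (Ordinal tm); rewrite /shift3 /=.
  (* A zero among [a4], [a5], [a6] makes the common difference nonnegative, so [b4 - a4] does not
     truncate. *)
  by apply/eqP; congr [:: _; _; _; _; _; _]; case/or3P: up => /eqP; lia.
rewrite /m0 in t1.
have I3 (i : 'I_3) : [\/ i = 0, i = 1 | i = 2].
  case: i => [[|[|[|//]]] Hi]; [exact: Or31 (val_inj _)
    | exact: Or32 (val_inj _) | exact: Or33 (val_inj _)].
apply/matrixP => i j.
by case: (I3 i) => ->; case: (I3 j) => ->;
  rewrite ?A1 ?A2 ?A3 ?A4 ?A5 ?A6 ?A7 ?A8 ?A9
          ?B1 ?B2 ?B3 ?B4 ?B5 ?B6 ?B7 ?B8 ?B9; lia.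
Qed.

Lemma num_paths_sum M a1 a2 a3 a4 a5 a6 : upshifted M a1 a2 a3 a4 a5 a6 ->
  num_paths M = (\sum_(t < (m0 a1 a2 a3).+1)
    multinomial (line_sum M) (shift3 a1 a2 a3 a4 a5 a6 t))%N.
Proof.
move=> ha; have [_ L] := represents_semi_magic ha.1.
pose w t := shift3 a1 a2 a3 a4 a5 a6 t.
have sw (t : 'I_(m0 a1 a2 a3).+1) : sumn (w t) = line_sum M.
  by have := ltn_ord t; rewrite L /m0 /=; lia.
under eq_bigr => t _.
  rewrite (@multinomial_card _ (w t)) ?sw // -sum1dep_card big_mkcond /=.
  over.
(* With the sum over words outside, it remains to see that each path to [M] is counted for exactly
   one [t], and other words for none. *)
rewrite exchange_big /= /num_paths -sum1dep_card [LHS]big_mkcond /=.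
apply: eq_bigr => p _; rewrite (represents_eq ha (represents_count p)).
under eq_bigr => t _ do rewrite has_content_coef3 //.
case: existsP => [[t /eqP Et]|none]; last first.
  rewrite big1 // => t _; case: eqP => // E.
  by case: none; exists t; rewrite -/(w t) -E.
rewrite (bigD1 t) //= Et eqxx big1 // => u ut.
(* The fourth count [a4 + t] determines [t]. *)
case: eqP => // -[_ _ _ /addnI E _ _].
by case/eqP: ut; apply: val_inj.
Qed.

(** * Factoring the multinomials, and F(M, -1) *)

Lemma multinomial_fact n s : sumn s = n ->
  (multinomial n s * \prod_(k <- s) k`! = n`!)%N.
Proof.
move=> sn; rewrite /multinomial sn eqxx divnK // -{}sn.
elim: s => [|k s IH]; first by rewrite big_nil.
rewrite big_cons /= -(bin_fact (leq_addr (sumn s) k)) addKn.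
by apply: dvdn_mull; apply: dvdn_mul.
Qed.

(** Multiplied by the six factorials, both sides become the factorial of [n]: each binomial turns
    its two factorials into that of the pair sum. *)
Lemma multinomial_pairs n x1 y1 x2 y2 x3 y3 :
    n = (x1 + x2 + x3 + (y1 + y2 + y3))%N ->
  multinomial n [:: x1; x2; x3; y1; y2; y3] =
  (multinomial n [:: x1 + y2; x2 + y3; x3 + y1] *
     ('C(x1 + y2, y2) * 'C(x3 + y1, y1) * 'C(x2 + y3, x2)))%N.
Proof.
move=> En.
have H6 : sumn [:: x1; x2; x3; y1; y2; y3] = n by rewrite /= En; lia.
have H3 : sumn [:: x1 + y2; x2 + y3; x3 + y1]%N = n by rewrite /= En; lia.
apply/eqP; rewrite -(@eqn_pmul2r (\prod_(k <- [:: x1; x2; x3; y1; y2; y3]) k`!)).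
  rewrite multinomial_fact // -(multinomial_fact H3) !big_cons !big_nil.
  rewrite -(bin_fact (leq_addl x1 y2)) -(bin_fact (leq_addr y3 x2)).
  rewrite -(bin_fact (leq_addl x3 y1)) !addnK addKn.
  by apply/eqP; ring.
by apply: prodn_gt0 => i; apply: fact_gt0.
Qed.

Lemma sum_ord_trunc (V : nmodType) (f : nat -> V) n N : (n <= N)%N ->
  (forall t, (n <= t < N)%N -> f t = 0) -> \sum_(t < N) f t = \sum_(t < n) f t.
Proof.
move=> nN f0; rewrite -!(big_mkord xpredT f) (@big_cat_nat _ _ _ n 0 N) //=.
by rewrite [X in _ + X]big_nat [X in _ + X]big1 ?addr0.
Qed.

Lemma C_upshiftedE M a1 a2 a3 a4 a5 a6 : upshifted M a1 a2 a3 a4 a5 a6 ->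
  C M = \sum_(t < (m0 a1 a2 a3).+1) (-1) ^+ (a2 - t) *
    ('C(a1 + a5, a5 + t) * 'C(a3 + a4, a4 + t) * 'C(a2 + a6, a2 - t))%:R.
Proof.
case=> Ra up; rewrite (C_sextupleE Ra).
pose f s : int := (-1) ^+ s *
  ('C(a1 + a5, a2 + a5 - s) * 'C(a3 + a4, a2 + a4 - s) * 'C(a2 + a6, s))%:R.
(* No term beyond [a2] survives: if [a4] or [a5] is 0 the range stops there, and if [a6] is 0 the
   last binomial vanishes. *)
rewrite (@sum_ord_trunc _ f a2.+1); first last.
- move=> s Hs; rewrite /f (@bin_small (a2 + a6)) ?muln0 ?mulr0 //.
  by case/or3P: up => /eqP; lia.
- lia.
rewrite (reindex_inj rev_ord_inj) /=.
(* After the substitution s = a2 - t, the first binomial vanishes for t > a1 and the second for t >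
   a3. *)
rewrite (@sum_ord_trunc _ (fun t => f (a2.+1 - t.+1)%N) (m0 a1 a2 a3).+1).
- apply: eq_bigr => t _; have := ltn_ord t; rewrite /m0 /f => Ht.
  congr (_ ^+ _ * (_ * _ * _)%:R); congr binomial; lia.
- by rewrite /m0; lia.
move=> t; rewrite /m0 /f => Ht.
have [H|H] := ltnP a1 t.
  by rewrite (@bin_small (a1 + a5)) ?mul0n ?mulr0 //; lia.
by rewrite (@bin_small (a3 + a4)) ?muln0 ?mul0n ?mulr0 //; lia.
Qed.

Theorem theorem7p2 (M : 'M[nat]_3) (a1 a2 a3 a4 a5 a6 : nat)
    (hM : semi_magic M) (ha : upshifted M a1 a2 a3 a4 a5 a6) :
  (F M a1 a2 a3 a4 a5 a6).[1] = (num_paths M)%:R /\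
  (F M a1 a2 a3 a4 a5 a6).[-1] =
    (-1) ^+ a2
    * (multinomial (line_sum M) [:: a1 + a5; a2 + a6; a3 + a4]%N)%:R
    * C M.
Proof.
have [_ L] := represents_semi_magic ha.1.
split; rewrite /F horner_sum.
  rewrite (num_paths_sum ha) natr_sum; apply: eq_bigr => t _.
  by rewrite hornerZ hornerXn expr1n mulr1.
rewrite (C_upshiftedE ha) mulr_sumr; apply: eq_bigr => -[t Ht] _ /=.
rewrite /m0 in Ht.
rewrite hornerZ hornerXn multinomial_pairs; last by rewrite L; lia.
have -> : (a1 - t + (a5 + t) = a1 + a5)%N by lia.
have -> : (a2 - t + (a6 + t) = a2 + a6)%N by lia.
have -> : (a3 - t + (a4 + t) = a3 + a4)%N by lia.
(* The sign from [C] has exponent [a2 - t]; it occurs twice in (-1)^a2 (-1)^(a2 - t) and squares to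
   1. *)
have -> : (-1) ^+ t = (-1) ^+ a2 * (-1) ^+ (a2 - t) :> int.
  have ta2 : (t <= a2)%N by lia.
  by rewrite -{1}(subnKC ta2) exprD -mulrA -expr2 sqrr_sign mulr1.
by rewrite natrM; ring.
Qed.
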